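(* Let $d$ be a positive integer, and fix a $d$-bounded bipartite graph $H$ which contains $K_{d,s}$ as a subgraph with $s$ sufficiently large in terms of $d$. Then $r_{\mathrm{ind}}(H,r)=\tilde{\Theta}(r^d)$ as $r\to\infty$.
   Context: For a graph $H$ and positive integer $r$, the induced Ramsey number $r_{\mathrm{ind}}(H,r)$ is the minimum $N$ for which there is a graph $G$ on $N$ vertices such that in every $r$-edge-coloring of $G$ there is a monochromatic induced copy of $H$. A bipartite graph $H=(A\cup B,E)$ is $d$-bounded if there are between $1$ and $d$ vertices in $A$ adjacent to all vertices of $B$, and every other vertex of $A$ has degree at most $d$. $\tilde{\Theta}$ means up to factors polylogarithmic in $r$ (constants may depend on $H$). *)

(* Defs.v *)
From mathcomp Require Import all_boot.
Set Implicit Arguments. Unset Strict Implicit. Unset Printing Implicit Defensive.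

Definition simple_graph (V : finType) (e : rel V) : Prop :=
  symmetric e /\ irreflexive e.

Definition Kbip_rel (d s : nat) : rel ('I_d + 'I_s)%type :=
  fun x y => match x, y with
             | inl _, inr _ => true
             | inr _, inl _ => true
             | _, _ => false
             end.

Definition subgraph (V W : finType) (eV : rel V) (eW : rel W) : Prop :=
  exists f : V -> W, injective f /\ forall u v, eV u v -> eW (f u) (f v).

Definition d_bounded (d : nat) (V : finType) (e : rel V) : Prop :=
  exists A : {set V},
    (forall u v, e u v -> (u \in A) != (v \in A)) /\
    let D := [set a in A | [forall b in ~: A, e a b]] in
    (1 <= #|D| <= d) /\
    (forall a, a \in A :\: D -> #|[set b | e a b]| <= d).

(* Some graph G on N vertices (vertex set 'I_N) is such that every
   r-edge-colouring of G contains a monochromatic induced copy of H = (V,e).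
   A colouring is a symmetric map from pairs of vertices to 'I_r (only its
   values on edges matter). *)
Definition ind_ramsey_witness (V : finType) (e : rel V) (r N : nat) : Prop :=
  exists G : rel 'I_N,
    simple_graph G /\
    forall c : 'I_N -> 'I_N -> 'I_r,
      (forall x y, c x y = c y x) ->
      exists f : V -> 'I_N,
        injective f /\
        (forall u v, G (f u) (f v) = e u v) /\
        exists k : 'I_r, forall u v, e u v -> c (f u) (f v) = k.
Arguments Kbip_rel d s : clear implicits.

(* Main.v *)
Require Import Defs.
From mathcomp Require Import all_boot all_algebra all_field zify.
Set Implicit Arguments. Unset Strict Implicit. Unset Printing Implicit Defensive.

(* Lower bound. Put q = 2^k <= r < 2q, K = F_(q^d), and colour the pair {u, v} of
   elements of K by the norm N(u + v), which takes at most q values. In a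
   monochromatic K_{d,s} with sides y_i and z, the conjugates x_j = z^(q^j) solve
   d equations prod_j (x_j - a_ij) = b_i in which, for each j, the a_ij are pairwise
   distinct. Such a system has at most d^d solutions: expanding in the Lagrange-type
   basis of the products prod_(i in J) (X - a_ij) with |J| >= d - 1, every monomial of
   degree at most d in each x_j is a combination, on the solution set, of monomials
   of degree less than d, so these d^d monomials span all functions there.

   Upper bound. Let G be a bipartite graph on N + N vertices, N = r^d (log r)^2, of
   small constant density, in which no L-set with L = O(log N) has L vertices joined
   to more than a 1/(2|V|) fraction of it. In the densest colour, dependent random
   choice gives d vertices T with a large common neighbourhood U in which almost every
   d-tuple has at least L common neighbours. The vertices of H complete to B go to T,
   B goes randomly into U, and each remaining vertex of A, having degree at most d, has
   L candidates, at least half of which miss the images of its non-neighbours. *)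

(** * Counting and union bounds *)

(* A lens [get]/[put] on [S]: overwriting the [Q]-component of a uniform
   element of [S] by an independent uniform value leaves it uniform. *)
Lemma sum_resample (S Q : finType) (get : S -> Q) (put : S -> Q -> S)
    (F : S -> nat) :
  (forall f q, get (put f q) = q) ->
  (forall f q q', put (put f q) q' = put f q') ->
  (forall f, put f (get f) = f) ->
  \sum_f \sum_q F (put f q) = #|Q| * \sum_f F f.
Proof.
move=> gp pp pg; rewrite pair_bigA /=.
pose sw (p : S * Q) := (put p.1 p.2, get p.1).
have swK : involutive sw by case=> f q; rewrite /sw /= gp pp pg.
rewrite (reindex sw) /=; last by exists sw => x _; apply: swK.
under eq_bigr do rewrite pp pg.
rewrite -(pair_bigA _ (fun (f : S) (_ : Q) => F f)) /= big_distrr /=.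
by apply: eq_bigr => f _; rewrite sum_nat_const.
Qed.

(** Resampling the values at the distinct points [b j] shows that a uniform map restricts to a
    uniform map on [J]. Clearing denominators keeps such probabilities in [nat]. *)
Lemma card_comp_preim (U V J : finType) (b : J -> V) (B : {set {ffun J -> U}}) :
  injective b ->
  #|U| ^ #|J| * #|[set f : {ffun V -> U} | [ffun j => f (b j)] \in B]|
    = #|U| ^ #|V| * #|B|.
Proof.
move=> b_inj.
pose get (f : {ffun V -> U}) := [ffun j => f (b j)].
pose put (f : {ffun V -> U}) (q : {ffun J -> U}) :=
  [ffun v => if [pick j | b j == v] is Some j then q j else f v].
have putb f q j : put f q (b j) = q j.
  by rewrite ffunE; case: pickP => [i /eqP/b_inj-> //|/(_ j)]; rewrite eqxx.
have := @sum_resample _ _ get put (fun f => get f \in B).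
rewrite card_ffun => H.
rewrite -[X in _ * X = _]sum1dep_card [X in _ * X = _]big_mkcond /= -H.
- rewrite -[X in _ = _ * X]sum1_card [X in _ = _ * X]big_mkcond /=.
  rewrite -card_ffun -sum_nat_const; apply: eq_bigr => f _.
  by apply: eq_bigr => q _; congr (nat_of_bool (_ \in B)); apply/ffunP=> j; rewrite ffunE putb.
- by move=> f q; apply/ffunP=> j; rewrite ffunE putb.
- by move=> f q q'; apply/ffunP=> v; rewrite !ffunE; case: pickP.
- by move=> f; apply/ffunP=> v; rewrite ffunE; case: pickP => // j /eqP <-; rewrite ffunE.
Qed.

Definition update (U V : finType) (f : {ffun V -> U}) (b : V) (y : U) :=
  [ffun v => if v == b then y else f v].

(** Resample [f b]: with all other values fixed, the event has probability at most [L / #|U|]. *)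
Lemma card_coord_event (U V : finType) (b : V) (E : pred {ffun V -> U}) (L : nat) :
  (forall f, #|[set y | E (update f b y)]| <= L) ->
  #|U| * #|[set f | E f]| <= #|U| ^ #|V| * L.
Proof.
move=> EL.
have := @sum_resample _ _ (fun f : {ffun V -> U} => f b)
  (fun f y => update f b y) E.
rewrite -[X in _ * X <= _]sum1dep_card [X in _ * X <= _]big_mkcond /= => <-.
- rewrite -card_ffun -sum_nat_const; apply: leq_sum => f _.
  by apply: leq_trans (EL f); rewrite -sum1dep_card [X in _ <= X]big_mkcond.
- by move=> f q; rewrite ffunE eqxx.
- by move=> f q q'; apply/ffunP=> v; rewrite !ffunE; case: eqP.
- by move=> f; apply/ffunP=> v; rewrite ffunE; case: eqP => // ->.
Qed.

Lemma card_bigcup_le (S I : finType) (E : I -> {set S}) :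
  #|\bigcup_i E i| <= \sum_i #|E i|.
Proof.
elim/big_rec2: _ => [|i m A _ IH]; first by rewrite cards0.
by rewrite (leq_trans (leq_card_setU _ _)) // leq_add2l.
Qed.

Lemma union_bound (S I : finType) (E : I -> {set S}) :
  \sum_i #|E i| < #|S| -> exists f, forall i, f \notin E i.
Proof.
move=> /(leq_ltn_trans (card_bigcup_le E)); rewrite -[#|S|]cardsT => lt.
have /set0Pn[f] : ~: (\bigcup_i E i) != set0.
  by rewrite -card_gt0 cardsCs setCK -cardsT subn_gt0.
rewrite inE => Hf; exists f => i; apply: contra Hf => fE.
by apply/bigcupP; exists i.
Qed.

Lemma pigeonhole (T : finType) (P : {set T}) (r : nat) (f : T -> 'I_r) :
  0 < r -> exists k, #|P| <= r * #|[set t in P | f t == k]|.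
Proof.
move=> r0; pose c k := #|[set t in P | f t == k]|.
have sumc : #|P| = \sum_k c k.
  rewrite -sum1_card (partition_big f xpredT) //=; apply: eq_bigr => k _.
  by rewrite sum1dep_card /c; apply: eq_card => t; rewrite !inE.
have [k _ kmax] := arg_maxnP (P := xpredT) c (i0 := Ordinal r0) isT.
exists k; rewrite sumc; apply: (@leq_trans (\sum_(i < r) c k)).
  by apply: leq_sum => i _; apply: kmax.
by rewrite sum_nat_const card_ord.
Qed.

Lemma enum_set (T : finType) (W : {set T}) (L : nat) : #|W| = L ->
  exists w : {ffun 'I_L -> T}, injective w /\ W = [set w i | i in 'I_L].
Proof.
move=> <-; exists [ffun i => enum_val i]; split.
  by move=> i j; rewrite !ffunE => /enum_val_inj.
apply/setP=> x; apply/idP/imsetP => [xW|[i _ ->]].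
  by exists (enum_rank_in xW x) => //; rewrite ffunE enum_rankK_in.
by rewrite ffunE enum_valP.
Qed.

Lemma subset_of_card (T : finType) (W : {set T}) (L : nat) : L <= #|W| ->
  exists2 Z : {set T}, Z \subset W & #|Z| = L.
Proof.
move=> LW; exists [set x in take L (enum W)].
  by apply/subsetP=> x; rewrite inE => /mem_take; rewrite mem_enum.
rewrite cardsE; have /card_uniqP -> : uniq (take L (enum W)).
  by apply: take_uniq; apply: enum_uniq.
by rewrite size_take -cardE; case: ltngtP LW.
Qed.

(* Union bound over [W], the set [Z] of [L] exceptional [y]'s and the set of
   cells of [W * Z] labelled [l]: a uniform labelling does this with probability
   at most [2 ^ (2nL + L^2 + 4h - 2L^2) < 1], because those cells number at least
   [L^2 / 2h] and there are [2 ^ 4h] labels. *)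
Lemma pseudorandom_labelling (h n L N : nat) :
  N <= 2 ^ n -> 2 * n + 4 * h < L ->
  exists g : {ffun 'I_N * 'I_N -> 'I_(2 ^ (4 * h))},
  forall l (W : {set 'I_N}), #|W| = L ->
    #|[set y | L < 2 * h * #|[set x in W | g (x, y) == l]|]| < L.
Proof.
move=> Nn hL; set M := 2 ^ (4 * h).
have M0 : 0 < M by rewrite expn_gt0.
pose I := ({ffun 'I_L -> 'I_N} * {ffun 'I_L -> 'I_N} * {set 'I_L * 'I_L} * 'I_M)%type.
(* A non-injective [w] or [z], or too few cells, gives the empty event, so that the union runs over
   a plain product type. *)
pose E (i : I) := let: (w, z, J, l) := i in
  if [&& injectiveb w, injectiveb z & L * L <= 2 * h * #|J|] then
  [set g : {ffun 'I_N * 'I_N -> 'I_M} | [forall p in J, g (w p.1, z p.2) == l]]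
  else set0.
have cardE i : 2 ^ (2 * (L * L)) * #|E i| <= M ^ (N * N).
  case: i => [[[w z] J] l] /=; case: ifP => [/and3P[/injectiveP winj /injectiveP zinj hJ]|_];
    last by rewrite cards0 muln0.
  pose b (p : {p | p \in J}) := (w (sval p).1, z (sval p).2).
  have b_inj : injective b.
    move=> [[p1 p2] pJ] [[q1 q2] qJ] [/winj/= e1 /zinj/= e2].
    by apply: val_inj; rewrite /= e1 e2.
  have := @card_comp_preim 'I_M _ _ b [set [ffun=> l]] b_inj.
  rewrite cards1 muln1 card_prod !card_ord card_sig.
  rewrite [X in X * #|_| = _](_ : _ = M ^ #|J|); last by congr (_ ^ _); apply: eq_card.
  move=> <-; apply: leq_mul.
    by rewrite -expnM leq_exp2l // -[4]/(2 * 2) -!mulnA leq_mul2l mulnA.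
  apply: subset_leq_card; apply/subsetP=> g; rewrite !inE => /forall_inP gl.
  by apply/eqP/ffunP=> -[p pJ]; rewrite !ffunE; apply/eqP; apply: gl.
have cardI : #|{: I}| < 2 ^ (2 * (L * L)).
  have cS : #|{: {set 'I_L * 'I_L}}| = 2 ^ (L * L).
    by rewrite -cardsT -powersetT card_powerset cardsT card_prod !card_ord.
  rewrite /I card_prod card_prod card_prod cS !card_ffun !card_ord.
  apply: (@leq_ltn_trans (2 ^ (n * L) * 2 ^ (n * L) * 2 ^ (L * L) * 2 ^ (4 * h))).
    by rewrite !leq_mul // expnM leq_exp2r //; lia.
  rewrite -!expnD ltn_exp2l //; nia.
have : \sum_i #|E i| < #|{: {ffun 'I_N * 'I_N -> 'I_M}}|.
  rewrite card_ffun card_prod !card_ord.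
  have p0 : 0 < 2 ^ (2 * (L * L)) by rewrite expn_gt0.
  rewrite -(ltn_pmul2l p0) big_distrr /=.
  apply: (@leq_ltn_trans (\sum_(i : I) M ^ (N * N))); first by apply: leq_sum.
  by rewrite sum_nat_const ltn_pmul2r // expn_gt0 M0.
case/union_bound=> g gE; exists g => l W WL; rewrite ltnNge; apply/negP.
case/subset_of_card=> Z /subsetP ZW ZL.
have [w [winj Ww]] := enum_set WL; have [z [zinj Zz]] := enum_set ZL.
pose J := [set p : 'I_L * 'I_L | g (w p.1, z p.2) == l].
have := gE (w, z, J, l); rewrite /E.
have -> : [&& injectiveb w, injectiveb z & L * L <= 2 * h * #|J|].
  apply/and3P; split; [exact/injectiveP|exact/injectiveP|].
  (* Count [J] by columns: each of the [L] columns in [Z] holds more than [L / 2h] cells. *)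
  have -> : #|J| = \sum_j #|[set x in W | g (x, z j) == l]|.
    rewrite -sum1dep_card big_mkcond /=.
    rewrite -(pair_bigA _ (fun i j => if g (w i, z j) == l then 1 else 0)) exchange_big.
    apply: eq_bigr => j _; rewrite -big_mkcond sum1dep_card -(card_imset _ winj).
    apply: eq_card => x; rewrite Ww !inE; apply/imsetP/andP => [[i]|[/imsetP[i _ ->] gi]].
      by rewrite inE => gi ->; split => //; apply/imsetP; exists i.
    by exists i => //; rewrite inE.
  rewrite big_distrr -{1}(card_ord L) -sum_nat_const; apply: leq_sum => j _.
  have : z j \in [set y | L < 2 * h * #|[set x in W | g (x, y) == l]|].
    by apply: ZW; rewrite Zz imset_f.
  by rewrite inE => /ltnW.
by rewrite inE => /negP; apply; apply/forall_inP=> p; rewrite inE.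
Qed.

(** * Dependent random choice *)

(** The two sides differ by [(b - a) * (b ^ k - a ^ k)], whose factors never have opposite signs. *)
Lemma mul_pow_rearrange (a b k : nat) :
  a * b ^ k + b * a ^ k <= a ^ k.+1 + b ^ k.+1.
Proof.
wlog ab : a b / a <= b.
  by case/orP: (leq_total a b) => H W; [|rewrite addnC [leqRHS]addnC]; apply: W.
have: a ^ k <= b ^ k by case: (k) => // j; rewrite leq_exp2r.
rewrite !expnS; nia.
Qed.

Lemma power_mean (Y : finType) (f : Y -> nat) (d : nat) :
  (\sum_y f y) ^ d.+1 <= #|Y| ^ d * \sum_y f y ^ d.+1.
Proof.
(* Chebyshev's sum inequality: symmetrise the double sum and compare it pair by pair. *)
have step k : (\sum_y f y) * (\sum_y f y ^ k) <= #|Y| * \sum_y f y ^ k.+1.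
  have A : (\sum_y f y) * (\sum_y f y ^ k) = \sum_i \sum_j f i * f j ^ k.
    by rewrite big_distrlr.
  have B : #|Y| * (\sum_y f y ^ k.+1) = \sum_(i : Y) \sum_j f j ^ k.+1.
    by rewrite sum_nat_const.
  rewrite -(leq_pmul2l (isT : 0 < 2)) !mul2n -!addnn.
  rewrite {1}A A [X in X + _ <= _]exchange_big {1}B B [X in _ <= X + _]exchange_big -!big_split /=.
  apply: leq_sum => i _; rewrite -!big_split /=; apply: leq_sum => j _.
  by rewrite addnC mul_pow_rearrange.
elim: d => [|d IH]; first by rewrite expn1 mul1n; apply/eq_leq/eq_bigr => y _; rewrite expn1.
rewrite expnS; apply: leq_trans (leq_mul (leqnn _) IH) _.
by rewrite mulnCA expnSr -mulnA leq_mul2l step orbT.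
Qed.

Lemma card_forall_ffun (X : finType) (d : nat) (P : pred X) :
  #|[set T : {ffun 'I_d -> X} | [forall i, P (T i)]]| = #|P| ^ d.
Proof.
rewrite -[d in RHS]card_ord -card_ffun_on; apply: eq_card => T; rewrite inE.
by apply/forallP/ffun_onP.
Qed.

Lemma card_non_injective (X : finType) (d : nat) :
  #|X| * #|[set T : {ffun 'I_d -> X} | ~~ injectiveb T]| <= #|X| ^ d * (d * d).
Proof.
pose E (p : 'I_d * 'I_d) := [set T : {ffun 'I_d -> X} | (p.1 != p.2) && (T p.1 == T p.2)].
apply: (@leq_trans (#|X| * \sum_p #|E p|)).
  rewrite leq_mul2l; apply/orP; right.
  apply: leq_trans (card_bigcup_le E).
  apply: subset_leq_card; apply/subsetP=> T; rewrite inE => /injectivePn[i [j ij Tij]].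
  by apply/bigcupP; exists (i, j) => //; rewrite inE /= ij Tij eqxx.
rewrite big_distrr /=.
have -> : d * d = #|{: 'I_d * 'I_d}| by rewrite card_prod card_ord.
rewrite mulnC -sum_nat_const; apply: leq_sum => [[i j]] _.
have := @card_coord_event X _ i (fun T => (i != j) && (T i == T j)) 1.
rewrite card_ord muln1; apply=> T /=.
have [->|ij] := eqVneq i j; first by rewrite leqW // leqn0 cards_eq0; apply/eqP/setP=> y; rewrite !inE.
rewrite -(cards1 (T j)); apply: subset_leq_card; apply/subsetP=> y.
by rewrite !inE !ffunE eqxx [j == i]eq_sym (negPf ij).
Qed.

(* Averages over all [T]: the mean of [#|U T|] is large by convexity, while a
   tuple [Q] with fewer than [L] common neighbours lies in [U T] for fewer than
   [L ^ d] of the [T]'s. *)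
Lemma dependent_random_choice (X Y : finType) (R : X -> Y -> bool)
    (d N L C K D : nat) :
  #|X| = N -> #|Y| = N -> 0 < d -> 0 < L -> 0 < C ->
  N * N <= D * #|[set p : X * Y | R p.1 p.2]| ->
  D ^ d * (C * L + K * L + d * d) < N ->
  exists T : {ffun 'I_d -> X}, injective T /\
    let U := [set y | [forall i, R (T i) y]] in
    C * L <= #|U| /\
    K * #|[set Q : {ffun 'I_d -> Y} | [forall i, Q i \in U] &&
             (#|[set x | [forall i, R x (Q i)]]| < L)]| < #|U| ^ d.
Proof.
move=> XN YN d0 L0 C0 dens big.
pose U (T : {ffun 'I_d -> X}) := [set y | [forall i, R (T i) y]].
pose bad (Q : {ffun 'I_d -> Y}) := #|[set x | [forall i, R x (Q i)]]| < L.
pose B T := [set Q : {ffun 'I_d -> Y} | [forall i, Q i \in U T] && bad Q].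
have N0 : 0 < N by apply: leq_ltn_trans big.
case: (pickP (fun T : {ffun 'I_d -> X} => [&& injectiveb T, C * L <= #|U T| & K * #|B T| < #|U T| ^ d])).
  by move=> T /and3P[/injectiveP Ti T1 T2]; exists T.
move=> none; exfalso; move: big; apply/negP; rewrite -leqNgt.
(* The weight [(C * L) ^ d.-1] puts the three ways to fail into one inequality linear in [#|U T|];
   when [U T] is large, the weighted size is at most [#|U T| ^ d]. *)
have bndT (T : {ffun 'I_d -> X}) : (C * L) ^ d.-1 * #|U T| <=
    (C * L) ^ d + K * #|B T| + (C * L) ^ d.-1 * (N * ~~ injectiveb T).
  have := none T; case: injectiveb => /=; last first.
    move=> _; rewrite muln1; apply: leq_trans (leq_addl _ _).
    by rewrite leq_mul2l -YN max_card orbT.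
  rewrite !muln0 addn0; case: (leqP (C * L) #|U T|) => /= [u1 /negbT|u1 _]; last first.
    apply: leq_trans (leq_addr _ _).
    by rewrite -[d in leqRHS](prednK d0) expnSr leq_mul2l (ltnW u1) orbT.
  rewrite -leqNgt => u2; apply: leq_trans (leq_addl _ _); apply: leq_trans u2.
  rewrite -[d in leqRHS](prednK d0) expnSr leq_mul2r.
  by case: (d.-1) => [|k]; rewrite ?orbT // leq_exp2r // u1 orbT.
have sumU : \sum_T #|U T| = \sum_y #|[pred x | R x y]| ^ d.
  under eq_bigr => T _ do rewrite -sum1dep_card big_mkcond /=.
  rewrite exchange_big; apply: eq_bigr => y _.
  by rewrite -big_mkcond sum1dep_card (card_forall_ffun _ [pred x | R x y]).
have sumdeg : \sum_y #|[pred x | R x y]| = #|[set p : X * Y | R p.1 p.2]|.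
  rewrite -[RHS]sum1dep_card [RHS]big_mkcond /=.
  rewrite -(pair_bigA _ (fun x y => if R x y then 1 else 0)) [RHS]exchange_big.
  by apply: eq_bigr => y _; rewrite -big_mkcond sum1_card.
(* Convexity: the sizes of the [U T] add up to the sum of the [d]-th powers of the degrees, which
   average at least [N / D]. *)
have lowU : N ^ d.+1 <= D ^ d * \sum_T #|U T|.
  rewrite -(@leq_pmul2l (N ^ d.-1)) ?expn_gt0 ?N0 //.
  rewrite -expnD (_ : d.-1 + d.+1 = d + d); last by lia.
  rewrite expnD -expnMn; apply: (@leq_trans ((D * #|[set p : X * Y | R p.1 p.2]|) ^ d)).
    by rewrite leq_exp2r.
  rewrite expnMn mulnCA leq_mul2l sumU -sumdeg; apply/orP; right.
  by have := power_mean (fun y => #|[pred x | R x y]|) d.-1; rewrite prednK // YN.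
have sumB : \sum_T #|B T| <= N ^ d * L ^ d.
  under eq_bigr => T _ do rewrite -sum1dep_card big_mkcond /=.
  rewrite exchange_big /= -{1}YN -[d in #|Y| ^ d]card_ord -card_ffun -sum_nat_const.
  apply: leq_sum => Q _; rewrite -big_mkcond /= sum1dep_card.
  have [badQ|nbadQ] := boolP (bad Q); last first.
    by rewrite (_ : #|_| = 0) //; apply: eq_card0 => T; rewrite !inE andbF.
  apply: (@leq_trans (#|[set x | [forall i, R x (Q i)]]| ^ d)); last by rewrite leq_exp2r // ltnW.
  rewrite -card_forall_ffun; apply: subset_leq_card; apply/subsetP=> T.
  rewrite !inE andbT => /forallP H; apply/forallP=> i.
  suff: T i \in [set x | [forall i, R x (Q i)]] by [].
  rewrite inE; apply/forallP=> j.
  by have := H j; rewrite inE => /forallP.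
have sumI : \sum_(T : {ffun 'I_d -> X}) N * ~~ injectiveb T <= N ^ d * (d * d).
  rewrite -big_distrr /= -{1 2}XN; apply: leq_trans (card_non_injective _ _).
  by rewrite leq_mul2l -sum1dep_card [X in _ <= X]big_mkcond /= leqnn orbT.
have cardT : #|{: {ffun 'I_d -> X}}| = N ^ d by rewrite card_ffun card_ord XN.
have CL0 : 0 < (C * L) ^ d.-1 by rewrite expn_gt0 muln_gt0 C0 L0.
have upU : \sum_T #|U T| <= N ^ d * (C * L + K * L + d * d).
  rewrite -(leq_pmul2l CL0) big_distrr /=.
  apply: leq_trans; first by apply: leq_sum => T _; apply: bndT.
  rewrite !big_split /= sum_nat_const cardT -!big_distrr /=.
  have Ld : L ^ d <= (C * L) ^ d.-1 * L.
    rewrite -[d in leqLHS](prednK d0) expnSr leq_mul2r; apply/orP; right.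
    by case: (d.-1) => // k; rewrite leq_exp2r // leq_pmull.
  have -> : (C * L) ^ d = (C * L) ^ d.-1 * (C * L) by rewrite -expnSr prednK.
  move: sumI; rewrite -big_distrr /= => sumI.
  have := leq_mul (leqnn K) sumB.
  have := leq_mul (leqnn ((C * L) ^ d.-1)) sumI.
  have := leq_mul (leqnn (K * N ^ d)) Ld.
  clear; move: (\sum_T #|B T|) (\sum_i _) ((C * L) ^ d.-1) (N ^ d) (L ^ d) => a b p q l.
  lia.
rewrite -(@leq_pmul2l (N ^ d)) ?expn_gt0 ?N0 // -expnSr.
apply: leq_trans lowU _; rewrite mulnCA leq_mul2l; by rewrite upU orbT.
Qed.

(** * Induced embeddings *)

(* A uniform [f] works with positive probability; the event [E a b] is controlled
   by resampling the single value [f b]. *)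
Lemma random_map (V U : finType) (d L : nat) (Bad : {set {ffun 'I_d -> U}})
    (E : V -> V -> pred {ffun V -> U}) :
  0 < d ->
  (forall a b f, #|[set y | E a b (update f b y)]| <= L) ->
  2 * (#|V| * #|V| * L) <= #|U| ->
  2 * (#|V| ^ d * #|Bad|) < #|U| ^ d ->
  exists f : {ffun V -> U}, (forall a b, ~~ E a b f) /\
    forall b : {ffun 'I_d -> V}, injective b -> [ffun j => f (b j)] \notin Bad.
Proof.
move=> d0 EL U1 U2.
have u0 : 0 < #|U| by move: U2; case: #|U| => //; rewrite exp0n.
pose F (i : (V * V) + {ffun 'I_d -> V}) := match i with
  | inl p => [set f | E p.1 p.2 f]
  | inr b => if injectiveb b then [set f : {ffun V -> U} | [ffun j => f (b j)] \in Bad] else set0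
  end.
(* Each of the two families of events gets half of the probability space, the second strictly
   less. *)
have sumE : 2 * \sum_(p : V * V) #|F (inl p)| <= #|U| ^ #|V|.
  rewrite -(leq_pmul2l u0) mulnCA big_distrr /=.
  apply: (@leq_trans (2 * \sum_(p : V * V) #|U| ^ #|V| * L)).
    by rewrite leq_mul2l /=; apply: leq_sum => -[a b] _; apply: card_coord_event.
  rewrite sum_nat_const card_prod.
  have := leq_mul U1 (leqnn (#|U| ^ #|V|)).
  by move: (#|U| ^ #|V|) #|U| #|V| => x y z; lia.
have sumB : 2 * \sum_(b : {ffun 'I_d -> V}) #|F (inr b)| < #|U| ^ #|V|.
  have p0 : 0 < #|U| ^ d by rewrite expn_gt0 u0.
  have p1 : 0 < #|U| ^ #|V| by rewrite expn_gt0 u0.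
  rewrite -(ltn_pmul2l p0) mulnCA big_distrr /=.
  apply: (@leq_ltn_trans (2 * \sum_(b : {ffun 'I_d -> V}) #|U| ^ #|V| * #|Bad|)).
    rewrite leq_mul2l /=; apply: leq_sum => b _; case: injectiveP => [binj|_]; last first.
      by rewrite cards0 muln0.
    by rewrite -(card_comp_preim Bad binj) card_ord.
  rewrite sum_nat_const card_ffun card_ord.
  move: U2; rewrite -(ltn_pmul2l p1).
  by move: (#|U| ^ #|V|) (#|U| ^ d) (#|V| ^ d) => x y z; lia.
have : \sum_i #|F i| < #|{: {ffun V -> U}}|.
  by rewrite card_ffun big_sumType /=; move: sumE sumB => /=; lia.
case/union_bound=> f Hf; exists f; split=> [a b|b binj].
  by have := Hf (inl (a, b)); rewrite /F inE.
have := Hf (inr b); rewrite /F.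
by move/injectiveP: binj => ->; rewrite inE.
Qed.

(** Greedy choice: each [R a] has at least [#|S|] elements, so one is still free at every stage. *)
Lemma distinct_representatives (V X : finType) (R : V -> {set X}) (S : {set V}) (x0 : X) :
  (forall a, a \in S -> #|S| <= #|R a|) ->
  exists x : V -> X, {in S &, injective x} /\ forall a, a \in S -> x a \in R a.
Proof.
move=> SR.
suff H s : uniq s -> (forall a, a \in s -> size s <= #|R a|) ->
    exists x : V -> X, {in s &, injective x} /\ forall a, a \in s -> x a \in R a.
  have [|x [xi xR]] := H _ (enum_uniq (mem S)).
    by move=> a; rewrite mem_enum -cardE; apply: SR.
  exists x; split=> [a b aS bS|a aS]; first by apply: xi; rewrite mem_enum.
  by apply: xR; rewrite mem_enum.
elim: s => [|a s IH] /=; first by exists (fun=> x0).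
case/andP=> aNs us sR.
have [|x [xi xR]] := IH us.
  by move=> b bs; apply: ltnW; apply: sR; rewrite inE bs orbT.
have /subsetPn[y yR yN] : ~~ (R a \subset [set x b | b in s]).
  apply/negP=> /subset_leq_card.
  have := sR a (mem_head _ _); move=> /leq_trans H /H.
  rewrite ltnNge => /negP; apply; apply: leq_trans (leq_imset_card _ _) _.
  exact: card_size.
exists (fun b => if b == a then y else x b); split.
  have xs b : b \in s -> x b != y.
    by move=> bs; apply: contraNneq yN => <-; apply: imset_f.
  move=> b c; rewrite !inE.
  case: (eqVneq b a) => [->|_] /=; case: (eqVneq c a) => [->|_] //= bs cs.
  - by move=> e; have := xs _ cs; rewrite -e eqxx.
  - by move=> e; have := xs _ bs; rewrite e eqxx.
  - exact: xi.
move=> b; rewrite inE; case: eqP => [-> //|_ /= bs]; exact: xR.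
Qed.

(** Pads a neighbourhood of at most [d] vertices to an injective [d]-tuple, the form in which common
    neighbours are controlled. *)
Lemma injective_cover (V : finType) (S : {set V}) (d : nat) :
  #|S| <= d <= #|V| ->
  exists b : {ffun 'I_d -> V}, injective b /\ forall v, v \in S -> exists i, b i = v.
Proof.
case/andP=> Sd dV.
have [|Z ZS Zc] := @subset_of_card V (~: S) (#|V| - d).
  by rewrite cardsCs setCK leq_sub2l.
have cZ : #|~: Z| = d by rewrite cardsCs setCK Zc subKn.
have [b [binj bZ]] := enum_set cZ; exists b; split=> // v vS.
have : v \in ~: Z by rewrite inE; apply: contraL vS => /(subsetP ZS); rewrite inE.
by rewrite bZ => /imsetP[i _ ->]; exists i.
Qed.

(* [D] goes to [T], so that all of [U] is adjacent to it; the other vertices [b]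
   go to [U] by a random map [f], and each [a] outside [D] to a common neighbour of
   [f @: N a] in a fixed [L]-subset [W f a] of it. Since [W f a] depends only on the
   restriction of [f] to [N a], pseudorandomness bounds, for [b] outside [N a], the
   number of values of [f b] with too many [G]-neighbours in [W f a]. *)
Lemma bipartite_embedding (V : finType) (e : rel V) (A : {set V}) (d L : nat)
    (X Y : finType) (G R : X -> Y -> bool) (T : {ffun 'I_d -> X}) :
  let D := [set a in A | [forall b in ~: A, e a b]] in
  let U := [set y | [forall i, R (T i) y]] in
  0 < d <= #|V| ->
  #|D| <= d ->
  (forall a, a \in A :\: D -> #|[set b | e a b]| <= d) ->
  4 * #|V| < L ->
  (forall W : {set X}, #|W| = L ->
     #|[set y | L < 2 * #|V| * #|[set x in W | G x y]|]| < L) ->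
  (forall x y, R x y -> G x y) ->
  injective T ->
  2 * (#|V| * #|V| * L.+1) <= #|U| ->
  2 * #|V| ^ d * #|[set Q : {ffun 'I_d -> Y} | [forall i, Q i \in U] &&
             (#|[set x | [forall i, R x (Q i)]]| < L)]| < #|U| ^ d ->
  exists (fX : V -> X) (fY : V -> Y),
    [/\ {in A &, injective fX}, injective fY &
     forall a b, a \in A -> b \notin A ->
       G (fX a) (fY b) = e a b /\ (e a b -> R (fX a) (fY b))].
Proof.
move=> D U /andP[d0 dV] Dd degA hL pseudo RG Tinj U1 U2.
pose U' : finType := {y | y \in U}.
have cU : #|U'| = #|U| by rewrite card_sig; apply: eq_card.
pose Bad := [set Q : {ffun 'I_d -> U'} | #|[set x | [forall i, R x (sval (Q i))]]| < L].
pose N (f : {ffun V -> U'}) a := [set x | [forall b, e a b ==> R x (sval (f b))]].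
pose W f a := [set x in take L (enum (N f a))].
have cW f a : L <= #|N f a| -> #|W f a| = L.
  move=> LN; rewrite /W cardsE; have /card_uniqP -> : uniq (take L (enum (N f a))).
    exact/take_uniq/enum_uniq.
  by rewrite size_take -cardE; case: ltngtP LN.
have WN f a x : x \in W f a -> x \in N f a.
  by rewrite inE => /mem_take; rewrite mem_enum.
pose E a b (f : {ffun V -> U'}) := (a != b) && (f a == f b) ||
  [&& ~~ e a b, L <= #|N f a| &
      L < 2 * #|V| * #|[set x in W f a | G x (sval (f b))]|].
have cardE a b f : #|[set y | E a b (update f b y)]| <= L.+1.
  have updb y : update f b y b = y by rewrite ffunE eqxx.
  have updN y c : c != b -> update f b y c = f c by rewrite ffunE => /negPf->.
  have N_upd y : ~~ e a b -> N (update f b y) a = N f a.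
    move=> neab; apply/setP=> x; rewrite !inE; apply: eq_forallb => c.
    by case: (eqVneq c b) => [->|/updN -> //]; rewrite (negPf neab).
  pose Z := [set y : U' | [&& ~~ e a b, L <= #|N f a| &
      L < 2 * #|V| * #|[set x in W f a | G x (sval y)]|]].
  have cZ : #|Z| <= L.
    have [LN|/negPf nLN] := boolP (L <= #|N f a|); last first.
      by rewrite (_ : Z = set0) ?cards0 //; apply/setP=> y; rewrite !inE nLN andbF.
    have injv : injective (fun y : U' => sval y) by move=> x y /val_inj.
    rewrite -(card_imset _ injv); apply/ltnW/leq_ltn_trans/(pseudo _ (cW _ _ LN)).
    apply: subset_leq_card; apply/subsetP=> _ /imsetP[y yZ ->].
    by move: yZ; rewrite !inE => /and3P[].
  (* The value [f a] accounts for a collision; pseudorandomness bounds the others by [L]. *)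
  apply: (@leq_trans #|f a |: Z|).
    apply: subset_leq_card; apply/subsetP=> y; rewrite !inE /E updb.
    case/orP=> [/andP[ab]|/and3P[neab]].
      by rewrite updN // => /eqP <-; rewrite eqxx.
    by rewrite /W N_upd // neab => -> ->; rewrite orbT.
  by apply: leq_trans (leq_card_setU _ _) _; rewrite cards1 add1n.
have [f [fE fBad]] : exists f : {ffun V -> U'}, (forall a b, ~~ E a b f) /\
    forall b : {ffun 'I_d -> V}, injective b -> [ffun j => f (b j)] \notin Bad.
  apply: random_map d0 cardE _ _; rewrite cU //.
  apply: leq_ltn_trans U2; rewrite mulnA leq_mul2l; apply/orP; right.
  pose m (Q : {ffun 'I_d -> U'}) := [ffun i => sval (Q i)] : {ffun 'I_d -> Y}.
  have minj : injective m.
    move=> P Q /ffunP PQ; apply/ffunP=> i; apply: val_inj.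
    by have := PQ i; rewrite !ffunE.
  rewrite -(card_imset _ minj); apply: subset_leq_card; apply/subsetP=> _ /imsetP[Q QB ->].
  rewrite inE; apply/andP; split; first by apply/forallP=> i; rewrite ffunE; apply: (svalP (Q i)).
  move: QB; rewrite inE; apply: leq_ltn_trans; apply/eq_leq/eq_card => x; rewrite !inE.
  by apply: eq_forallb => i; rewrite ffunE.
have finj : injective f.
  move=> a b fab; apply/eqP; apply: contraNT (fE a b) => ab.
  by rewrite /E ab fab eqxx.
have NL a : a \in A :\: D -> L <= #|N f a|.
  move=> aAD; have [|b [binj bcov]] := @injective_cover V [set b | e a b] d.
    by rewrite degA.
  have := fBad b binj; rewrite inE -leqNgt => /leq_trans; apply.
  apply: subset_leq_card; apply/subsetP=> x; rewrite !inE => /forallP H.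
  apply/forallP=> c; apply/implyP=> eac.
  have [|i <-] := bcov c; first by rewrite inE.
  by have := H i; rewrite ffunE.
pose M a := [set x in W f a | [forall b, ~~ e a b ==> ~~ G x (sval (f b))]] :\: [set T i | i in 'I_d].
(* At least half of the [L] candidates survive the non-neighbours and at most [d] lie in [T]; since
   [4 * #|V| < L], enough remain for a greedy choice. *)
have cM a : a \in A :\: D -> #|A :\: D| <= #|M a|.
  move=> aAD; apply: leq_trans (max_card _) _.
  pose S b := [set x in W f a | ~~ e a b && G x (sval (f b))].
  have cS b : 2 * #|V| * #|S b| <= L.
    have := fE a b; rewrite /E negb_or NL //= => /andP[_].
    have [eab _|neab] := boolP (e a b) => /=.
      by rewrite (_ : S b = set0) ?cards0 ?muln0 //; apply/setP=> x; rewrite !inE eab andbF.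
    rewrite -leqNgt => /(leq_trans _); apply; rewrite leq_mul2l; apply/orP; right.
    by apply: subset_leq_card; apply/subsetP=> x; rewrite !inE neab.
  have cT : #|[set T i | i in 'I_d]| <= d.
    by apply: leq_trans (leq_imset_card _ _) _; rewrite card_ord.
  have cov : W f a \subset M a :|: [set T i | i in 'I_d] :|: \bigcup_b S b.
    apply/subsetP=> x xW; rewrite in_setU in_setU in_setD.
    case: (x \in [set T i | i in 'I_d]); first by rewrite orbT.
    rewrite orbF /= inE xW /=; case: forallP => //= /forallP.
    rewrite negb_forall => /existsP[b]; rewrite negb_imply negbK => H.
    by apply/bigcupP; exists b => //; rewrite inE xW.
  have := subset_leq_card cov; rewrite cW ?NL // => LM.
  have cbig : 2 * #|\bigcup_b S b| <= L.
    have V0 : 0 < #|V| by apply: leq_trans dV.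
    rewrite -(leq_pmul2l V0) mulnA [#|V| * 2]mulnC.
    apply: (@leq_trans (2 * #|V| * \sum_b #|S b|)).
      by rewrite leq_mul2l card_bigcup_le orbT.
    by rewrite big_distrr -sum_nat_const; apply: leq_sum.
  have := (leq_card_setU (M a :|: [set T i | i in 'I_d]) (\bigcup_b S b)).1.
  have := (leq_card_setU (M a) [set T i | i in 'I_d]).1.
  move: cT cbig LM; lia.
have [x [xinj xM]] := @distinct_representatives V X M (A :\: D) (T (Ordinal d0)) cM.
have [j jinj] : exists j : V -> 'I_d, {in D &, injective j}.
  have [|j [jinj _]] := @distinct_representatives V 'I_d (fun=> setT) D (Ordinal d0).
    by move=> a _; rewrite cardsT card_ord.
  by exists j.
have xT a i : a \in A :\: D -> x a != T i.
  move=> /xM; rewrite in_setD => /andP[+ _].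
  by apply: contraNneq => ->; apply: imset_f.
have AD a : a \in A -> a \notin D -> a \in A :\: D by rewrite in_setD => -> ->.
exists (fun a => if a \in D then T (j a) else x a), (fun b => sval (f b)); split.
- move=> a b aA bA; case: ifPn => aD; case: ifPn => bD.
  + by move=> /Tinj; apply: jinj.
  + by move=> /esym/eqP; rewrite (negPf (xT _ _ _)) ?AD.
  + by move=> /eqP; rewrite (negPf (xT _ _ _)) ?AD.
  + by apply: xinj; apply: AD.
- by move=> a b /val_inj /finj.
move=> a b aA bA; case: ifPn => aD.
  have eab : e a b.
    by move: aD; rewrite inE aA /= => /forall_inP; apply; rewrite inE.
  have Rab : R (T (j a)) (sval (f b)).
    by have := svalP (f b); rewrite inE => /forallP; apply.
  by rewrite eab RG.
have := xM _ (AD _ aA aD); rewrite in_setD inE => /and3P[_ xW /forallP/(_ b)].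
have := WN _ _ _ xW; rewrite inE => /forallP/(_ b).
case: (e a b) => /= [Rab _|_ /negPf ->]; last by [].
by rewrite RG.
Qed.

(** * The upper bound *)

Lemma ind_ramsey_upper (d : nat) (V : finType) (e : rel V) :
  0 < d <= #|V| -> simple_graph e -> d_bounded d e ->
  exists r0, forall r, r0 <= r ->
    ind_ramsey_witness e r (r ^ d * trunc_log 2 r ^ 2 + r ^ d * trunc_log 2 r ^ 2).
Proof.
move=> d0V [e_sym _] [A [bip [/andP[D1 Dd] degA]]].
have /andP[d0 dV] := d0V.
set v := #|V| in dV; have v0 : 0 < v by apply: leq_trans dV.
pose M := 2 ^ (4 * v).
have M0 : 0 < M by rewrite expn_gt0.
pose C := 4 * (v * v); pose K := 2 * v ^ d.
pose B := (C + K) * (4 * d + 4 * v + 5) + d * d.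
(* This forces [M ^ d * B < l]: one factor [l] of [N] absorbs the constants, the other pays for
   [L = O(l)]. *)
exists (2 ^ (M ^ d * B).+1) => r r_big.
set l := trunc_log 2 r; set N := r ^ d * l ^ 2.
have r0 : 0 < r by apply: leq_trans r_big; rewrite expn_gt0.
have /andP[_ rl] := trunc_log_bounds (isT : 1 < 2) r0; rewrite -/l in rl.
have lB : M ^ d * B < l by apply: trunc_log_max.
have l0 : 0 < l by apply: leq_ltn_trans lB.
pose n := d * l.+1 + 2 * l; pose L := (2 * n + 4 * v).+1.
have Nn : N <= 2 ^ n.
  rewrite /N /n expnD mulnC [2 ^ _ * _]mulnC; apply: leq_mul.
    by rewrite mulnC expnM leq_exp2r // ltnW // ltn_expl.
  by rewrite mulnC expnM leq_exp2r // ltnW.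
have LB : C * L + K * L + d * d <= B * l.
  have Ll : L <= (4 * d + 4 * v + 5) * l by rewrite /L /n; nia.
  have := leq_mul (leqnn (C + K)) Ll; have := leq_mul (leqnn (d * d)) l0.
  by rewrite /B; clearbody C K L l v; move: (4 * d + 4 * v + 5) => w; lia.
have DN : (M * r) ^ d * (C * L + K * L + d * d) < N.
  apply: (@leq_ltn_trans ((M * r) ^ d * (B * l))); first by rewrite leq_mul2l LB orbT.
  rewrite /N expnMn [M ^ d * _]mulnC -mulnA ltn_pmul2l ?expn_gt0 ?r0 //.
  by rewrite mulnA expnS expn1 ltn_pmul2r.
have [g gL] := @pseudorandom_labelling v n L N Nn (ltnSn _).
have [k gk] := @pigeonhole _ [set: 'I_N * 'I_N] _ g M0.
pose G0 (x y : 'I_N) := g (x, y) == k.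
pose G (u w : 'I_(N + N)) := match split u, split w with
  | inl x, inr y => G0 x y | inr y, inl x => G0 x y | _, _ => false end.
exists G; split.
  split=> [u w|u]; rewrite /G; last by case: (split u).
  by case: (split u) => x; case: (split w).
move=> c csym.
have [i Ri] := @pigeonhole _ [set p | G0 p.1 p.2] _ (fun p => c (lshift N p.1) (rshift N p.2)) r0.
pose R x y := G0 x y && (c (lshift N x) (rshift N y) == i).
(* Choosing the label costs a factor [M] in density, choosing the colour a factor [r]. *)
have dens : N * N <= M * r * #|[set p : 'I_N * 'I_N | R p.1 p.2]|.
  move: gk; rewrite cardsT card_prod card_ord => /leq_trans; apply.
  rewrite -mulnA leq_mul2l; apply/orP; right.
  apply: leq_trans (leq_trans Ri _).
    by apply/eq_leq/eq_card => -[x y]; rewrite !inE.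
  by rewrite leq_mul2l; apply/orP; right; apply/eq_leq/eq_card => p; rewrite !inE.
have C0 : 0 < C by rewrite /C !muln_gt0 v0.
have [T [Tinj [U1 U2]]] := @dependent_random_choice _ _ R d N L C K (M * r)
  (card_ord N) (card_ord N) d0 (ltn0Sn _) C0 dens DN.
have hL : 4 * #|V| < L by rewrite /L ltnS leq_addl.
have RG x y : R x y -> G0 x y by case/andP.
have U1' : 2 * (#|V| * #|V| * L.+1) <= #|[set y | [forall i, R (T i) y]]|.
  by apply: leq_trans U1; rewrite /C -/v /L; move: (v * v) (2 * n + 4 * v); lia.
have [fX [fY [fXi fYi fG]]] := @bipartite_embedding V e A d L _ _ G0 R T
  d0V Dd degA hL (gL k) RG Tinj U1' U2.
pose h a := if a \in A then inl (fX a) else inr (fY a) : 'I_N + 'I_N.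
exists (fun a => unsplit (h a)); split; [|split].
- move=> a b /(can_inj unsplitK); rewrite /h.
  case: ifP => aA; case: ifP => bA //= [].
    exact: fXi.
  exact: fYi.
- move=> a b; rewrite /G !unsplitK /h.
  case: ifPn => aA; case: ifPn => bA.
  + by apply/esym/negbTE/negP=> /bip; rewrite aA bA.
  + by have [] := fG a b aA bA.
  + by have [-> _] := fG b a bA aA; rewrite e_sym.
  + by apply/esym/negbTE/negP=> /bip; rewrite (negPf aA) (negPf bA).
exists i => a b eab; rewrite /h; have := bip _ _ eab.
case: ifPn => aA; case: ifPn => bA //= _.
  by have [_ /(_ eab)/andP[_ /eqP]] := fG a b aA bA.
by have [_] := fG b a bA aA; rewrite e_sym => /(_ eab)/andP[_ /eqP]; rewrite csym.
Qed.

(** * Norm colourings *)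

Section NormSystem.
Import GRing.Theory.
Local Open Scope ring_scope.

Variables (K : fieldType) (t : nat) (I : finType).
Variables (x : 'I_t -> I -> K) (a : 'I_t -> 'I_t -> K).

(* A function on the solution set [I] is viewed as a vector of [K ^ I]; the
   bound comes from showing that the [t ^ t] monomials of degree less than [t] in
   each coordinate already span it. *)
Definition monomial_fun (e : {ffun 'I_t -> 'I_t}) : {ffun I -> K^o} :=
  [ffun p => \prod_j x j p ^+ e j].
Definition monomial_span : {vspace {ffun I -> K^o}} :=
  <<[seq monomial_fun e | e : {ffun 'I_t -> 'I_t}]>>%VS.
Definition prod_fun (q : 'I_t -> {poly K}) : {ffun I -> K^o} :=
  [ffun p => \prod_j (q j).[x j p]].

Lemma prod_fun_low (q : 'I_t -> {poly K}) :
  (forall j, size (q j) <= t)%N -> prod_fun q \in monomial_span.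
Proof.
move=> qt.
have -> : prod_fun q = \sum_(e : {ffun 'I_t -> 'I_t})
    (\prod_j (q j)`_(e j)) *: monomial_fun e.
  apply/ffunP=> p; rewrite ffunE sum_ffunE.
  under eq_bigr => j _ do rewrite (horner_coef_wide _ (qt j)).
  rewrite bigA_distr_bigA; apply: eq_bigr => e _.
  by rewrite !ffunE big_split.
apply: memv_suml => e _; apply/memvZ/memv_span; apply/mapP.
by exists e => //; rewrite mem_enum.
Qed.

(** Up to scaling, [Some i] gives the Lagrange polynomials of the nodes [a i j]; [None] adds one of
    full degree [t]. *)
Definition node_poly j (k : option 'I_t) : {poly K} :=
  \prod_(i | Some i != k) ('X - (a i j)%:P).

Lemma size_node_prod (P : pred 'I_t) j :
  size (\prod_(i | P i) ('X - (a i j)%:P)) = #|P|.+1.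
Proof.
rewrite (eq_bigl (fun i => i \in P)) // -big_enum size_prod_XsubC -cardE.
by congr _.+1; apply: eq_card.
Qed.

(** A multiple of the monic [None] polynomial removes the coefficient of degree [t]; Lagrange
    interpolation at [t] distinct nodes gives the rest. *)
Lemma node_poly_basis j (q : {poly K}) : injective (a^~ j) ->
  (size q <= t.+1)%N -> exists c : option 'I_t -> K,
  q = \sum_k c k *: node_poly j k.
Proof.
move=> a_inj qt.
pose q1 := q - q`_t *: node_poly j None.
have sizeN : size (node_poly j None) = t.+1.
  by rewrite size_node_prod; congr _.+1; rewrite -[RHS]card_ord; apply: eq_card.
have sizeS i : size (node_poly j (Some i)) = t.
  rewrite size_node_prod (cardC1 i) card_ord prednK //.
  exact: leq_ltn_trans (ltn_ord i).
have monN : node_poly j None \is monic by apply: monic_prod_XsubC.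
have q1t : (size q1 <= t)%N.
  apply/leq_sizeP => m tm; rewrite coefB coefZ.
  have [->|ltm] := eqVneq m t.
    by move/monicP: monN; rewrite lead_coefE sizeN /= => ->; rewrite mulr1 subrr.
  have tm1 : (t < m)%N by rewrite ltn_neqAle eq_sym ltm.
  rewrite (nth_default _ (leq_trans qt tm1)) [(node_poly _ _)`_m]nth_default ?sizeN //.
  by rewrite mulr0 subr0.
have nodeS i k : i != k -> (node_poly j (Some k)).[a i j] = 0.
  move=> ik; rewrite horner_prod (bigD1 i) //= ?hornerXsubC ?subrr ?mul0r //.
have nodeSS k : (node_poly j (Some k)).[a k j] != 0.
  rewrite horner_prod prodf_seq_neq0; apply/allP=> i _; apply/implyP=> ik.
  rewrite hornerXsubC subr_eq0; apply: contraNneq ik => /a_inj ->; exact: eqxx.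
exists (fun k => if k is Some i then q1.[a i j] / (node_poly j (Some i)).[a i j] else q`_t).
rewrite (bigD1 None) //= (reindex_omap Some id) /=; last by case.
rewrite (eq_bigl xpredT) => [|i]; last by rewrite eqxx.
rewrite -[LHS](subrK (q`_t *: node_poly j None)) addrC; congr (_ + _).
rewrite -/q1; apply/eqP; rewrite -subr_eq0; apply/eqP.
apply: (@roots_geq_poly_eq0 _ _ [seq a i j | i : 'I_t]).
- apply/allP=> _ /mapP[i _ ->]; rewrite rootE hornerD hornerN horner_sum.
  rewrite (bigD1 i) //= big1 ?addr0 => [|k ki]; last first.
    have ik : i != k by rewrite eq_sym.
    by rewrite hornerZ (nodeS _ _ ik) mulr0.
  by rewrite hornerZ divfK // subrr.
- by rewrite map_inj_uniq ?enum_uniq.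
rewrite size_map -cardE card_ord (leq_trans (size_polyD _ _)) // geq_max q1t size_polyN.
apply: (leq_trans (size_sum _ _ _)); apply/bigmax_leqP => i _.
by rewrite (leq_trans (size_scale_leq _ _)) ?sizeS.
Qed.

Hypothesis a_inj : forall j, injective (a^~ j).
Variable b : 'I_t -> K.
Hypothesis system : forall i p, \prod_j (x j p - a i j) = b i.

(* If some factor is of the full degree [t], then by pigeonhole some row [i]
   of [a] divides every factor, and the [i]-th equation lowers all degrees. *)
Lemma prod_node_poly (k : {ffun 'I_t -> option 'I_t}) :
  prod_fun (fun j => node_poly j (k j)) \in monomial_span.
Proof.
have [/forallP kS|] := boolP [forall j, k j != None].
  apply: prod_fun_low => j; case: (k j) (kS j) => // i _.
  rewrite size_node_prod (cardC1 i) card_ord prednK //.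
  exact: leq_ltn_trans (ltn_ord i).
rewrite negb_forall => /existsP[j0]; rewrite negbK => /eqP kj0.
have [i ik] : exists i, forall j, k j != Some i.
  pose S := [set i | [exists j, k j == Some i]].
  have : (#|S| < t)%N.
    have Ssub : [set Some i | i in S] \subset [set k j | j in [set~ j0]].
      apply/subsetP=> _ /imsetP[i + ->]; rewrite inE => /existsP[j /eqP kj].
      apply/imsetP; exists j => //; rewrite !inE; apply: contra_eq_neq kj => ->.
      by rewrite kj0.
    rewrite -(card_imset _ (@Some_inj _)).
    apply: leq_ltn_trans (subset_leq_card Ssub) _.
    apply: leq_ltn_trans (leq_imset_card _ _) _.
    by rewrite cardsC1 card_ord ltn_predL; apply: leq_ltn_trans (ltn_ord j0).
  move=> St; have /subsetPn[i _ iS] : ~~ ([set: 'I_t] \subset S).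
    by apply/negP=> /subset_leq_card; rewrite cardsT card_ord leqNgt St.
  exists i => j; apply: contra iS => kj; rewrite inE; apply/existsP; by exists j.
have -> : prod_fun (fun j => node_poly j (k j)) =
    b i *: prod_fun (fun j => \prod_(i' | (Some i' != k j) && (i' != i)) ('X - (a i' j)%:P)).
  apply/ffunP=> p; rewrite !ffunE -(system i p) -[RHS]big_split /=.
  apply: eq_bigr => j _; rewrite /node_poly (bigD1 i) /=; last by rewrite eq_sym.
  by rewrite hornerM hornerXsubC.
apply/memvZ/prod_fun_low => j; rewrite size_node_prod.
apply: leq_ltn_trans (subset_leq_card (B := mem [set~ i]) _) _.
  by apply/subsetP=> i'; rewrite !inE => /andP[].
by rewrite cardsC1 card_ord ltn_predL; apply: leq_ltn_trans (ltn_ord j0).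
Qed.

(** Expansion in the node bases reduces this to [prod_node_poly], and gains one degree per
    coordinate over [prod_fun_low]. *)
Lemma prod_fun_high (q : 'I_t -> {poly K}) :
  (forall j, size (q j) <= t.+1)%N -> prod_fun q \in monomial_span.
Proof.
move=> qt.
have [c qc] : exists c : {ffun 'I_t -> {ffun option 'I_t -> K}},
    forall j, q j = \sum_k c j k *: node_poly j k.
  have H j : exists c : {ffun option 'I_t -> K}, q j == \sum_k c k *: node_poly j k.
    have [c ->] := node_poly_basis (a_inj (j := j)) (qt j); exists (finfun c).
    by apply/eqP/eq_bigr => k _; rewrite ffunE.
  by exists [ffun j => xchoose (H j)] => j; rewrite ffunE; apply/eqP/(xchooseP (H j)).
have -> : prod_fun q = \sum_(k : {ffun 'I_t -> option 'I_t})
    (\prod_j c j (k j)) *: prod_fun (fun j => node_poly j (k j)).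
  apply/ffunP=> p; rewrite ffunE sum_ffunE.
  under eq_bigr => j _ do rewrite qc horner_sum.
  rewrite bigA_distr_bigA; apply: eq_bigr => k _.
  by rewrite !ffunE -[RHS]big_split; apply: eq_bigr => j _; rewrite hornerZ.
by apply: memv_suml => k _; apply/memvZ/prod_node_poly.
Qed.

Definition shift_mul j c (f : {ffun I -> K^o}) : {ffun I -> K^o} :=
  [ffun p => (x j p - c) * f p].

(** A spanning monomial times [x j - c] has degree at most [t] in each coordinate, so
    [prod_fun_high] applies. *)
Lemma shift_mul_closed j c (f : {ffun I -> K^o}) :
  f \in monomial_span -> shift_mul j c f \in monomial_span.
Proof.
set m := [seq monomial_fun e | e : {ffun 'I_t -> 'I_t}].
move=> fW; have -> : shift_mul j c f =
    \sum_i coord (in_tuple m) i f *: shift_mul j c m`_i.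
  apply/ffunP=> p; rewrite ffunE {1}(@coord_span _ _ _ (in_tuple m) f fW).
  rewrite !sum_ffunE mulr_sumr; apply: eq_bigr => i _.
  by rewrite !ffunE; apply: mulrCA.
apply: memv_suml => i _; apply: memvZ.
have : m`_i \in m by apply: mem_nth.
case/mapP=> e _ ->.
have -> : shift_mul j c (monomial_fun e) =
    prod_fun (fun i => 'X^(e i) * (if i == j then 'X - c%:P else 1)).
  apply/ffunP=> p; rewrite !ffunE.
  under [RHS]eq_bigr => k _ do rewrite hornerM hornerXn.
  rewrite big_split /= mulrC; congr (_ * _).
  rewrite (bigD1 j) //= eqxx hornerXsubC big1 ?mulr1 // => k /negPf ->.
  exact: hornerC.
apply: prod_fun_high => k; case: eqP => _.
  by rewrite size_Mmonic ?monicXsubC -?size_poly_eq0 ?size_polyXn // size_XsubC addn2 /= ltnS.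
by rewrite mulr1 size_polyXn ltnS ltnW.
Qed.

Hypothesis separated : forall p p', (forall j, x j p = x j p') -> p = p'.

(** Factors [x j - x j p] kill the points [p] one at a time, so the span contains all indicator
    functions. The full function space, of dimension [#|I|], is thus spanned by [t ^ t]
    monomials. *)
Lemma card_norm_system : (0 < t)%N -> (#|I| <= t ^ t)%N.
Proof.
move=> t0.
have sep (p0 : I) (s : seq I) : p0 \notin s ->
    exists f, [/\ f \in monomial_span, f p0 = 1 & {in s, forall p, f p = 0}].
  elim: s => [|p s IH].
    move=> _; exists (prod_fun (fun=> 1)); split=> //.
      by apply: prod_fun_low => j; rewrite size_poly1.
    by rewrite ffunE big1 // => j _; rewrite hornerC.
  rewrite inE negb_or => /andP[p0p /IH[f [fW f0 fs]]].
  have [j xj] : exists j, x j p0 != x j p.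
    apply/existsP; rewrite -negb_forall; apply: contra p0p => /forallP H.
    by apply/eqP/separated => j; apply/eqP.
  exists ((x j p0 - x j p)^-1 *: shift_mul j (x j p) f); split.
  - exact/memvZ/shift_mul_closed.
  - by rewrite !ffunE f0 mulr1; apply: mulVf; rewrite subr_eq0.
  move=> p'; rewrite inE !ffunE => /orP[/eqP ->|/fs ->].
    by rewrite subrr mul0r; apply: mulr0.
  by rewrite mulr0; apply: mulr0.
have fullW : (fullv <= monomial_span)%VS.
  have [d dP] : exists d : I -> {ffun I -> K^o}, forall p0,
      [/\ d p0 \in monomial_span, d p0 p0 = 1 & forall p, p != p0 -> d p0 p = 0].
    pose good (p0 : I) (f : {ffun I -> K^o}) :=
      [&& f \in monomial_span, f p0 == 1 & [forall p, (p != p0) ==> (f p == 0)]].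
    have H p0 : exists f, good p0 f.
      have [|f [fW f0 fs]] := sep p0 (enum [set~ p0]); first by rewrite mem_enum !inE eqxx.
      exists f; rewrite /good fW f0 eqxx; apply/forallP=> p; apply/implyP=> pp0.
      by rewrite fs // mem_enum !inE.
    exists (fun p0 => xchoose (H p0)) => p0.
    have /and3P[dW /eqP d0 /forallP dz] := xchooseP (H p0); split=> // p pp0.
    by apply/eqP; apply: (implyP (dz p)).
  apply/subvP=> f _.
  have -> : f = \sum_p f p *: d p.
    apply/ffunP=> p0; rewrite sum_ffunE (bigD1 p0) //= big1 ?addr0.
      by have [_ d0 _] := dP p0; rewrite ffunE d0; apply/esym/mulr1.
    by move=> p pp0; have [_ _ dz] := dP p; rewrite ffunE dz 1?eq_sym //; apply: mulr0.
  by apply: memv_suml => p _; apply: memvZ; have [] := dP p.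
have := leq_trans (dimvS fullW) (dim_span _).
rewrite size_map -cardE card_ffun card_ord.
by rewrite dimvf /dim /= muln1.
Qed.

End NormSystem.

Section NormColouring.
Import GRing.Theory.
Local Open Scope ring_scope.

Lemma norm_colouring (d k : nat) : (0 < d)%N -> (0 < k)%N ->
  exists (K : finType) (c : K -> K -> 'I_(2 ^ k)),
    [/\ (#|K| = (2 ^ k) ^ d)%N, forall u v, c u v = c v u &
     forall (s : nat) (y : 'I_d -> K) (z : 'I_s -> K) h,
       injective y -> injective z -> (forall i j, c (y i) (z j) = h) ->
       (s <= d ^ d)%N].
Proof.
move=> d0 k0; have dk0 : (0 < k * d)%N by rewrite muln_gt0 k0.
have [K charK cardK] := pPrimePowerField (isT : prime 2) dk0.
rewrite expnM in cardK; set q := (2 ^ k)%N in cardK *.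
have q1 : (1 < q)%N by rewrite -(expn0 2) ltn_exp2l.
have q0 : (0 < q)%N by apply: ltnW.
have powD m (u v : K) : (u + v) ^+ (q ^ m) = u ^+ (q ^ m) + v ^+ (q ^ m).
  by apply: exprDn_pchar; rewrite -expnM pnatX pnatE // charK.
have pow_inj m : injective (fun u : K => u ^+ (q ^ m)).
  move=> u v /= uv; apply/eqP; rewrite -subr_eq0.
  have : (u - v) ^+ (q ^ m) == 0.
    by rewrite -(inj_eq (addIr (v ^+ (q ^ m)))) -powD subrK add0r uv.
  by rewrite expf_eq0 => /andP[].
pose Nm (u : K) := \prod_(j < d) u ^+ (q ^ j).
(* The Frobenius power permutes the factors cyclically, since [u ^+ (q ^ d) = u]. *)
have Nm_fix u : Nm u ^+ q = Nm u.
  rewrite /Nm -prodrXl; case: (d) d0 cardK => // d' _ cardK'.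
  rewrite big_ord_recr [RHS]big_ord_recl /= mulrC; congr (_ * _).
    by rewrite -exprM -expnSr -cardK' expf_card expn0.
  by apply: eq_bigr => j _; rewrite -exprM -expnSr.
pose S := [set u : K | u ^+ q == u].
have cardS : (#|S| <= q)%N.
  have sizeP : size ('X^q - 'X : {poly K}) = q.+1.
    by rewrite size_polyDl size_polyXn // size_polyN size_polyX ltnS.
  rewrite -ltnS -sizeP cardE; apply: max_poly_roots.
  - by rewrite -size_poly_eq0 sizeP.
  - by apply/allP=> u; rewrite mem_enum inE rootE !hornerE => /eqP ->; rewrite subrr.
  - exact: enum_uniq.
have [h [h_inj _]] := @distinct_representatives K 'I_q (fun=> setT) S (Ordinal q0)
  (fun a _ => leq_trans cardS (eq_leq (esym (etrans (cardsT _) (card_ord q))))).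
exists K, (fun u v => h (Nm (u + v))); split=> // [u v|s y z h0 y_inj z_inj mono].
  by rewrite addrC.
have NS u : Nm u \in S by rewrite inE Nm_fix.
(* Norms of one colour agree, so the right-hand sides can be read off at [z ord0]; hence [s = 0] is
   split off. *)
case: s z z_inj mono => // s z z_inj mono; rewrite -[leqLHS]card_ord.
apply: (@card_norm_system K d 'I_s.+1 (fun j p => z p ^+ (q ^ j))
  (fun i j => - y i ^+ (q ^ j)) _ (fun i => Nm (y i + z ord0))) => //.
- by move=> j i i' /oppr_inj/pow_inj/y_inj.
- move=> i p; rewrite -[RHS](h_inj (Nm (y i + z p))) ?mono //.
  by apply: eq_bigr => j _; rewrite opprK addrC powD.
- by move=> p p' /(_ (Ordinal d0)) /pow_inj/z_inj.
Qed.

End NormColouring.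

(** * The lower bound and the conclusion *)

Lemma ind_ramsey_lower (d s r N : nat) (V : finType) (e : rel V) :
  0 < d -> d ^ d < s -> 1 < r -> subgraph (Kbip_rel d s) e ->
  ind_ramsey_witness e r N -> r ^ d <= 2 ^ d * N.
Proof.
move=> d0 ds r1 [g [g_inj ge]] [G [_ HG]].
set k := trunc_log 2 r.
have /andP[kr rk] := trunc_log_bounds (isT : 1 < 2) (ltnW r1); rewrite -/k in kr rk.
have k0 : 0 < k by apply: trunc_log_max.
(* Rounding [r] down to a power of two costs at most a factor [2 ^ d]. *)
apply: (@leq_trans (2 ^ d * (2 ^ k) ^ d)).
  by rewrite -expnMn -expnS leq_exp2r // ltnW.
rewrite leq_mul2l; apply/orP; right; rewrite leqNgt; apply/negP=> Nk.
have [K [c [cardK c_sym c_free]]] := norm_colouring d0 k0.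
have NK : N <= #|K| by rewrite cardK ltnW.
pose i (x : 'I_N) : K := enum_val (widen_ord NK x).
have i_inj : injective i by move=> x y /enum_val_inj/(congr1 val)/= /val_inj.
have [x y|f [f_inj [_ [h mono]]]] := HG (fun x y => widen_ord kr (c (i x) (i y))).
  by rewrite c_sym.
move: ds; rewrite ltnNge => /negP; apply.
case: (posnP s) => [-> //|s0].
(* The common colour lives in ['I_r]; one fixed edge supplies it in ['I_(2 ^ k)]. *)
have mono' u v : c (i (f (g (inl u)))) (i (f (g (inr v)))) =
    c (i (f (g (inl (Ordinal d0))))) (i (f (g (inr (Ordinal s0))))).
  apply/val_inj/eqP; have H u' v' := congr1 val (mono _ _ (ge (inl u') (inr v') isT)).
  by move: (H u v) (H (Ordinal d0) (Ordinal s0)) => /= -> ->.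
apply: (c_free s _ _ _ _ _ mono').
  by move=> u v /i_inj/f_inj/g_inj[].
by move=> u v /i_inj/f_inj/g_inj[].
Qed.

(* r_ind(H,r) = Θ~(r^d): there are constants C > 0, k and r0 (depending on H)
   such that for all r >= r0, the induced Ramsey number (the least N with
   ind_ramsey_witness H r N) lies between r^d / (C (log2 r)^k) and
   C r^d (log2 r)^k. *)
Theorem theorem6p3 :
  forall d : nat, 0 < d ->
  exists s0 : nat, forall s : nat, s0 <= s ->
  forall (V : finType) (e : rel V),
    simple_graph e -> d_bounded d e -> subgraph (Kbip_rel d s) e ->
    exists C k r0 : nat, 0 < C /\
      forall r : nat, r0 <= r ->
        (exists N, ind_ramsey_witness e r N /\
                   N <= C * r ^ d * (trunc_log 2 r) ^ k) /\
        (forall N, ind_ramsey_witness e r N ->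
                   r ^ d <= C * N * (trunc_log 2 r) ^ k).
Proof.
move=> d d0; exists (d ^ d).+1 => s ds V e e_simple e_bounded e_sub.
have dV : d <= #|V|.
  have [g [g_inj _]] := e_sub.
  have gl_inj : injective (fun i : 'I_d => g (inl i)) by move=> i j /g_inj[].
  by rewrite -[leqLHS]card_ord -(card_imset _ gl_inj) max_card.
have d0V : 0 < d <= #|V| by rewrite d0.
have [r0 upper] := ind_ramsey_upper d0V e_simple e_bounded.
(* [2 ^ d] covers both the doubling [N + N] and the rounding of [r]; [r >= 2] makes the logarithm
   positive. *)
exists (2 ^ d), 2, (maxn r0 2); split=> [|r]; first by rewrite expn_gt0.
rewrite geq_max => /andP[r0r r2]; split.
  exists (r ^ d * trunc_log 2 r ^ 2 + r ^ d * trunc_log 2 r ^ 2).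
  split; first exact: upper.
  have two_d : 2 <= 2 ^ d by rewrite -{1}(expn1 2) leq_exp2l.
  by rewrite addnn -mul2n mulnA !leq_mul.
move=> N /(ind_ramsey_lower d0 ds r2 e_sub) /leq_trans; apply.
by rewrite leq_pmulr // expn_gt0; apply/orP; left; apply: trunc_log_max.
Qed.
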